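(* Let $f\in\mathbb C[U]$ be a polynomial in one variable such that $\mathcal L(f^m)=0$ for all integers $m\ge1$. Then $f=0$.
   Context: $\mathcal L:\mathbb C[U]\to\mathbb C$ is the $\mathbb C$-linear map defined by $\mathcal L(U^{\ell})=\ell!$ for all $\ell\ge0$. *)

(* Defs.v *)
From HB Require Import structures.
From mathcomp Require Import all_boot all_order all_algebra.
Set Implicit Arguments. Unset Strict Implicit. Unset Printing Implicit Defensive.
Import Order.TTheory GRing.Theory Num.Theory.
Local Open Scope ring_scope.

Definition Lfun (C : numClosedFieldType) (p : {poly C}) : C :=
  \sum_(i < size p) p`_i * (i`!)%:R.

(* Main.v *)
Require Import Defs.
From HB Require Import structures.
From mathcomp Require Import all_boot all_order all_algebra.
From mathcomp Require Import boolp zify ring.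
Import Order.TTheory GRing.Theory Num.Theory.
Local Open Scope ring_scope.

(** Write [f = g X^r] with [a = g(0) != 0], and let [S] be the ring generated by
    the coefficients of [f].  Since [j (g^m)_j = m (g' g^(m-1))_(j-1)], every
    coefficient of [g^m] but the constant one contributes a multiple of
    [m (rm)!] to [L(f^m)], so that [L(f^m) = (rm)! (a^m + m s)] with [s] in [S].
    If all these vanish, every [m] divides [a^m] in [S].  This is impossible: in
    a finitely generated domain [S] of characteristic 0, the powers of a given
    nonzero element have only finitely many prime divisors [p] among the
    integers.  This property passes from [S] to [S[b]]: compare leading
    coefficients if [b] is transcendental over [S]; otherwise replace the element
    by a nonzero multiple lying in [S] and compare constant terms after
    pseudo-division by a polynomial of minimal degree vanishing at [b]. *)

(** Each step of long division scales by [lead_coef g] instead of dividing by it, which keeps all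
    coefficients in [S]; [j] counts the steps. *)
Lemma pseudo_division (F : idomainType) (S : subringClosed F) (g h : {poly F}) :
  g != 0 -> g \is a polyOver S -> h \is a polyOver S ->
  exists j, exists2 st : {poly F} * {poly F},
    st.1 \is a polyOver S /\ st.2 \is a polyOver S &
    lead_coef g ^+ j *: h = st.1 * g + st.2 /\ (size st.2 < size g)%N.
Proof.
move=> g0 gS; have [n] := ubnP (size h).
elim: n h => // n IHn h; rewrite ltnS => hn hS.
have [hg|gh] := ltnP (size h) (size g).
  exists 0%N, (0, h); first by rewrite rpred0.
  by rewrite expr0 scale1r mul0r add0r.
have lcS (q : {poly F}) : q \is a polyOver S -> lead_coef q \in S.
  by move=> /polyOverP; apply.
pose d := (size h - size g)%N.
pose u : {poly F} := lead_coef h *: 'X^d.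
have uS : u \is a polyOver S.
  by rewrite polyOverZ ?lcS // polyOverXn.
pose h1 := lead_coef g *: h - u * g.
have h1S : h1 \is a polyOver S.
  by rewrite rpredB ?rpredM // polyOverZ // lcS.
have sg : (0 < size g)%N by rewrite size_poly_gt0.
have sh1 : (size h1 < n)%N.
  apply: leq_trans hn; rewrite -[size h]prednK ?(leq_trans sg) // ltnS.
  apply/leq_sizeP => i hi.
  rewrite /h1 /u -scalerAl mulrC coefB !coefZ coefMXn.
  rewrite ifN; last first.
    by rewrite -leqNgt (leq_trans _ hi) // /d -subn1 leq_sub2l.
  (* Above the top degree of [h] both terms vanish; at that degree they cancel. *)
  case: (ltngtP (size h).-1 i) hi => // hi _.
    have h_i : (size h <= i)%N by rewrite -(ltn_predK (leq_trans sg gh)).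
    have g_i : (size g <= i - d)%N.
      by rewrite -(subKn gh) leq_sub2r.
    by rewrite !nth_default // !mulr0 subr0.
  rewrite -hi -/(lead_coef h).
  have -> : ((size h).-1 - d = (size g).-1)%N by rewrite /d; lia.
  by rewrite -/(lead_coef g) mulrC subrr.
have [j [[s t] /= [sS tS] [E st]]] := IHn h1 sh1 h1S.
exists j.+1, (lead_coef g ^+ j *: u + s, t).
  by rewrite /= rpredD // polyOverZ // rpredX ?lcS.
split=> //=; rewrite mulrDl -addrA -E exprSr -scalerA.
by rewrite /h1 scalerBr -scalerAl addrC subrK.
Qed.

(** * Adjunction of one element to a subring *)

Section Adjunction.
Variables (F : idomainType) (S : subringClosed F) (a : F).

Definition adjoin : {pred F} :=
  fun z => `[< exists2 q : {poly F}, q \is a polyOver S & z = q.[a] >].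

Lemma adjoinP z :
  reflect (exists2 q : {poly F}, q \is a polyOver S & z = q.[a]) (z \in adjoin).
Proof. exact: asboolP. Qed.

Lemma adjoin_subring_closed : subring_closed adjoin.
Proof.
split=> [|x y /adjoinP[p pS ->] /adjoinP[q qS ->]|
          x y /adjoinP[p pS ->] /adjoinP[q qS ->]]; apply/adjoinP.
- by exists 1; rewrite ?rpred1 // hornerC.
- by exists (p - q); rewrite ?rpredB // hornerD hornerN.
- by exists (p * q); rewrite ?rpredM // hornerM.
Qed.

HB.instance Definition _ :=
  GRing.isSubringClosed.Build F adjoin adjoin_subring_closed.

Lemma horner_adjoin (q : {poly F}) : q \is a polyOver S -> q.[a] \in adjoin.
Proof. by move=> qS; apply/adjoinP; exists q. Qed.

Lemma adjoin_id : a \in adjoin.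
Proof. by rewrite -[a]hornerX horner_adjoin ?polyOverX. Qed.

Lemma adjoin_sub : {subset S <= adjoin}.
Proof. by move=> x xS; rewrite -[x](hornerC x a) horner_adjoin ?polyOverC. Qed.

Lemma algebraic_minimal :
  (exists2 g : {poly F}, g != 0 & g \is a polyOver S /\ root g a) ->
  exists2 g : {poly F}, g != 0 &
   [/\ g \is a polyOver S, root g a &
    forall h, h \is a polyOver S -> root h a -> (size h < size g)%N -> h = 0].
Proof.
move=> [g0 g0N [g0S g0a]].
pose Q n := `[< exists2 g : {poly F}, g != 0 &
                 [/\ g \is a polyOver S, root g a & size g = n] >].
have exQ : exists n, Q n by exists (size g0); apply/asboolP; exists g0.
case: (ex_minnP exQ) => n /asboolP[g gN [gS ga gn]] nmin.
exists g => //; split=> // h hS ha; rewrite gn => hn.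
apply/eqP; apply: contraLR hn => hN; rewrite -leqNgt nmin //.
by apply/asboolP; exists h.
Qed.

(* Euclid's algorithm applied to a polynomial representing [d] and to the
   minimal polynomial [g]. *)
Lemma adjoin_dvd_base (g : {poly F}) (d : F) :
  g != 0 -> g \is a polyOver S -> root g a ->
  (forall h, h \is a polyOver S -> root h a -> (size h < size g)%N -> h = 0) ->
  d \in adjoin -> d != 0 ->
  exists2 y, y \in adjoin & d * y \in S /\ d * y != 0.
Proof.
move=> gN gS ga gmin /adjoinP[q qS dq] dN.
(* Among polynomials over [S] whose value at [a] is a nonzero multiple of [d] in [S[a]], take [r] of
   least size; the aim is that [r] is constant. *)
pose Q n := `[< exists2 r : {poly F}, r \is a polyOver S &
  [/\ size r = n, r.[a] != 0 & exists2 y, y \in adjoin & r.[a] = d * y] >].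
have exQ : exists n, Q n.
  exists (size q); apply/asboolP; exists q => //; split=> //; rewrite -dq //.
  by exists 1; rewrite ?mulr1 // rpred1.
case: (ex_minnP exQ) => n /asboolP[r rS [rn raN [y yA ray]]] nmin.
have small t z : t \is a polyOver S -> (size t < size r)%N ->
    z \in adjoin -> t.[a] = d * z -> t.[a] = 0.
  move=> tS; rewrite rn => tn zA taz; apply/eqP; apply: contraLR tn => taN.
  by rewrite -leqNgt nmin //; apply/asboolP; exists t => //; split=> //; exists z.
have rN : r != 0 by apply: contraNneq raN => ->; rewrite horner0.
have lcgS : lead_coef g \in S by move/polyOverP: gS; apply.
have lcrS : lead_coef r \in S by move/polyOverP: rS; apply.
(* Otherwise the remainder of [r] modulo [g] would contradict the choice of [r], its value at [a]
   being a nonzero multiple of [r.[a]]. *)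
have rg : (size r < size g)%N.
  rewrite ltnNge; apply/negP => gr.
  have [j [[s t] /= [sS tS] [E st]]] := pseudo_division _ _ _ _ gN gS rS.
  have ta : t.[a] = lead_coef g ^+ j * r.[a].
    by rewrite -hornerZ E hornerD hornerM (rootP ga) mulr0 add0r.
  have /eqP : t.[a] = 0.
    apply: (small t (lead_coef g ^+ j * y)) => //.
    - exact: leq_trans gr.
    - by rewrite rpredM // rpredX // adjoin_sub.
    - by rewrite ta ray mulrCA.
  by rewrite ta mulf_eq0 expf_eq0 lead_coef_eq0 (negbTE gN) (negbTE raN) andbF.
have [r1|r1] := leqP (size r) 1.
  exists y => //; rewrite -ray; split=> //.
  by rewrite (size1_polyC r1) hornerC; move/polyOverP: rS; apply.
(* If [r] is not constant, minimality of [r] and then of [g] gives [t = 0], so [s] is a nonzero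
   polynomial vanishing at [a] and smaller than [g]. *)
have [j [[s t] /= [sS tS] [E st]]] := pseudo_division _ _ _ _ rN rS gS.
have Ea : s.[a] * r.[a] + t.[a] = 0.
  by rewrite -hornerM -hornerD -E hornerZ (rootP ga) mulr0.
have ta : t.[a] = 0.
  apply: (small t (- (s.[a] * y))) => //.
    by rewrite rpredN rpredM // horner_adjoin.
  by apply/eqP; rewrite mulrN mulrCA -ray eq_sym -subr_eq0 -oppr_eq0 opprB opprK addrC Ea.
have t0 : t = 0 by apply: gmin => //; [exact/rootP|exact: ltn_trans rg].
have sa : root s a.
  move/eqP: Ea; rewrite ta addr0 mulf_eq0 (negbTE raN) orbF; exact.
have lgN : lead_coef r ^+ j != 0 by rewrite expf_neq0 // lead_coef_eq0.
have sN : s != 0.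
  apply: contraNneq gN => s0; move/eqP: E.
  by rewrite s0 t0 mul0r addr0 scale_poly_eq0 (negbTE lgN).
suff /(gmin s sS sa)/eqP : (size s < size g)%N by rewrite (negbTE sN).
have := congr1 (size \o polyseq) E.
rewrite /= t0 addr0 size_scale // size_mul // => ->.
by rewrite -subn1 -addnBA ?(ltnW r1) // -[ltnLHS]addn0 ltn_add2l subn_gt0.
Qed.

End Adjunction.

(** The bound [B] is uniform in [k], so that the exponent may later be chosen equal to [p]. *)
Definition fin_prime_divisors (F : idomainType) (S : {pred F}) :=
  forall d : F, d \in S -> d != 0 ->
  exists B, forall p, prime p -> (B < p)%N ->
  forall x k, x \in S -> p%:R * x != d ^+ k.

Lemma fin_prime_divisors_adjoin (F : idomainType) (S : subringClosed F) (a : F) :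
  fin_prime_divisors F S -> fin_prime_divisors F (adjoin F S a).
Proof.
move=> PS d dA dN.
have [/algebraic_minimal[g gN [gS ga gmin]]|tr] :=
  pselect (exists2 g : {poly F}, g != 0 & g \is a polyOver S /\ root g a).
  have [y yA [eS eN]] := adjoin_dvd_base _ _ _ _ _ gN gS ga gmin dA dN.
  set e := d * y in eS eN; set c := lead_coef g.
  have cS : c \in S by move/polyOverP: gS; apply.
  have cN : c != 0 by rewrite lead_coef_eq0.
  (* The factor [c] absorbs the powers of the leading coefficient produced by pseudo-division. *)
  have [|B HB] := PS (e * c) (rpredM eS cS); first by rewrite mulf_neq0.
  exists B => p pp Bp x k xA; apply/eqP => pxd.
  have /adjoinP[h hS hE] : x * y ^+ k \in adjoin F S a by rewrite rpredM // rpredX.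
  have [j [[s t] /= [sS tS] [E st]]] := pseudo_division _ _ _ _ gN gS hS.
  have pta : p%:R * t.[a] = c ^+ j * e ^+ k.
    have -> : t.[a] = c ^+ j * h.[a].
      by rewrite -hornerZ E hornerD hornerM (rootP ga) mulr0 add0r.
    by rewrite -hE mulrCA [p%:R * _]mulrA pxd -exprMn.
  have ceS : c ^+ j * e ^+ k \in S by rewrite rpredM // rpredX.
  have sg : (1 < size g)%N by apply: root_size_gt1 ga.
  have /eqP : p%:R *: t - (c ^+ j * e ^+ k)%:P = 0.
    apply: gmin.
    - by rewrite rpredB ?polyOverC // polyOverZ // rpred_nat.
    - by apply/rootP; rewrite hornerD hornerN hornerZ hornerC pta subrr.
    - apply: leq_ltn_trans (size_polyD _ _) _; rewrite size_polyN gtn_max.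
      by rewrite (leq_ltn_trans (size_scale_leq _ _)) // (leq_ltn_trans (size_polyC_leq1 _)).
  rewrite subr_eq0 => /eqP /(congr1 (fun q : {poly F} => q`_0)).
  rewrite coefZ coefC /= => pt0.
  (* The cofactor turns [c ^+ j * e ^+ k] into the power [(e * c) ^+ (j + k)]. *)
  have t0S : t`_0 * (c ^+ k * e ^+ j) \in S.
    by rewrite rpredM ?rpredM ?rpredX //; move/polyOverP: tS; apply.
  move: (HB p pp Bp _ (j + k)%N t0S) => /eqP [].
  rewrite [LHS]mulrA pt0 !exprMn !exprD; ring.
move: dA => /adjoinP[q qS dq].
have qN : q != 0 by apply: contraNneq dN => q0; rewrite dq q0 horner0.
have lcS : lead_coef q \in S by move/polyOverP: qS; apply.
have [|B HB] := PS _ lcS; first by rewrite lead_coef_eq0.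
exists B => p pp Bp _ k /adjoinP[h hS ->]; apply/eqP => phd.
(* As [a] is transcendental over [S], an equality of values at [a] is one of polynomials. *)
have E : p%:R *: h = q ^+ k.
  apply: contrapT => /eqP; rewrite -subr_eq0 => neq0; apply: tr.
  exists (p%:R *: h - q ^+ k) => //; split.
    by rewrite rpredB ?rpredX // polyOverZ // rpred_nat.
  by apply/rootP; rewrite hornerD hornerN hornerZ horner_exp phd dq subrr.
have lhS : lead_coef h \in S by move/polyOverP: hS; apply.
have := HB p pp Bp _ k lhS.
by rewrite -lead_coef_exp -E lead_coefZ eqxx.
Qed.

(** * Finitely generated subrings in characteristic 0 *)

Section Characteristic0.
Variable F : numDomainType.

Definition integers : {pred F} := fun z => `[< exists n : int, z = n%:~R >].

Lemma integers_subring_closed : subring_closed integers.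
Proof.
split=> [|x y /asboolP[m ->] /asboolP[n ->]|x y /asboolP[m ->] /asboolP[n ->]];
  apply/asboolP.
- by exists 1.
- by exists (m - n); rewrite intrB.
- by exists (m * n); rewrite intrM.
Qed.

HB.instance Definition _ :=
  GRing.isSubringClosed.Build F integers integers_subring_closed.

Lemma fin_prime_divisors_integers : fin_prime_divisors F integers.
Proof.
move=> _ /asboolP[n ->]; rewrite intr_eq0 => nN.
exists `|n|%N => p pp np _ k /asboolP[x ->]; apply/eqP.
rewrite -[p%:R]/(p%:~R) -intrM -rmorphXn => /intr_inj /(congr1 absz).
rewrite abszM abszX /= => E.
have : (p %| `|n| ^ k)%N by rewrite -E dvdn_mulr.
rewrite Euclid_dvdX // => /andP[/dvdn_leq]; rewrite absz_gt0 nN => /(_ isT).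
by rewrite leqNgt np.
Qed.

Lemma fg_subring_fin_prime_divisors (s : seq F) :
  exists2 S : subringClosed F, {subset s <= S} & fin_prime_divisors F S.
Proof.
elim: s => [|a s [S sS PS]].
  by exists (GRing.SubringClosed.clone F integers _) => //; exact: fin_prime_divisors_integers.
exists (GRing.SubringClosed.clone F (adjoin F S a) _); last exact: fin_prime_divisors_adjoin.
move=> x; rewrite inE => /predU1P[->|xs]; first exact: adjoin_id.
exact/adjoin_sub/sS.
Qed.

End Characteristic0.

(** * Values of [Lfun] on powers *)

Lemma Lfun_mulXn (C : numClosedFieldType) (h : {poly C}) n :
  Lfun (h * 'X^n) = \sum_(i < size h) h`_i * ((n + i)`!)%:R.
Proof.
have [->|hN] := eqVneq h 0.
  by rewrite mul0r /Lfun size_poly0 !big_ord0.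
rewrite /Lfun size_mulXn // big_split_ord /= big1 ?add0r.
  by apply: eq_bigr => i _; rewrite coefMXn ltnNge leq_addr /= addKn.
by move=> i _; rewrite coefMXn ltn_ord mul0r.
Qed.

Lemma Lfun_exp_mulXn (C : numClosedFieldType) (S : subringClosed C)
    (g : {poly C}) r m :
  g != 0 -> g \is a polyOver S ->
  exists2 s, s \in S &
    Lfun ((g * 'X^r) ^+ m) = ((r * m)`!)%:R * (g`_0 ^+ m + m%:R * s).
Proof.
move=> gN gS; set n := (r * m)%N.
(* The derivative of [g ^+ m] is [m] times [w]. *)
pose w := g^`() * g ^+ m.-1.
have wS : w \is a polyOver S by rewrite rpredM ?rpredX // polyOver_deriv.
exists (\sum_(i < (size (g ^+ m)).-1) w`_i * (i`! * 'C(n + i.+1, n))%:R).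
  by apply: rpred_sum => i _; rewrite rpredM ?rpred_nat //; move/polyOverP: wS; apply.
rewrite exprMn -exprM -/n Lfun_mulXn.
have /prednK <- : (0 < size (g ^+ m))%N by rewrite size_poly_gt0 expf_neq0.
rewrite big_ord_recl /= addn0 mulrDr; congr (_ + _).
  by rewrite mulrC -!horner_coef0 horner_exp.
rewrite !mulr_sumr; apply: eq_bigr => i _.
(* The factor [i.+1] is split off to be paired with the coefficient of index [i.+1] as in a
   derivative. *)
have -> : ((n + i.+1)`! = n`! * (i`! * 'C(n + i.+1, n)) * i.+1)%N.
  rewrite -(bin_fact (leq_addr i.+1 n)) addKn factS; lia.
have E : (g ^+ m)`_i.+1 * i.+1%:R = m%:R * w`_i.
  by rewrite mulr_natr -coef_deriv deriv_exp coefMn mulr_natl.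
rewrite [bump 0 i]add1n natrM [_ * i.+1%:R]mulrC mulrA E natrM; ring.
Qed.

Theorem theorem4p9 (C : numClosedFieldType) (f : {poly C}) :
  (forall m : nat, (1 <= m)%N -> Lfun (f ^+ m) = 0) -> f = 0.
Proof.
move=> Lf; apply/eqP; apply/negPn/negP => fN.
have [r [g]] := multiplicity_XsubC f 0.
rewrite fN /= subr0 => g0 fE.
have gN : g != 0 by apply: contraNneq g0 => ->; rewrite root0.
have [S gsub PS] := fg_subring_fin_prime_divisors C g.
have gS : g \is a polyOver S by apply/allP.
have g0S : g`_0 \in S by move/polyOverP: gS; apply.
have [|B HB] := PS _ g0S; first by rewrite -horner_coef0.
(* The prime [p] serves both as the exponent [m] and as the forbidden divisor of a power of
   [g(0)]. *)
have [p Bp pp] := prime_above B.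
have [s sS LE] := Lfun_exp_mulXn C S g r p gN gS.
move: LE; rewrite -fE Lf ?prime_gt0 // => /esym/eqP.
rewrite mulf_eq0 pnatr_eq0 -leqn0 leqNgt fact_gt0 /= addr_eq0 => /eqP E.
have := HB p pp Bp (- s) p; rewrite rpredN => /(_ sS).
by rewrite mulrN E eqxx.
Qed.
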